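(* Let $(X,X^+)$ be an ordered Banach space with a generating and normal cone $X^+$. Let the operator $A:X^+\to X^+$ be the restriction to $X^+$ of a positive linear operator on $X$. Consider the discrete-time system $x(k+1)\le A(x(k))+u(k)$, $k\in\mathbb{Z}_+$, with $x(k),u(k)\in X^+$. Then the following statements are equivalent: (i) The system is exponentially ISS. (ii) The system satisfies the MLIM property. (iii) The operator $\mathrm{id}-A$ satisfies the MBI property. (iv) The spectral radius of $A$ satisfies $r(A)<1$.
   Context: An ordered Banach space $(X,X^+)$ is a real Banach space $X$ with a closed subset $X^+$ (cone) satisfying $X^+\cap(-X^+)=\{0\}$, $\mathbb{R}_+\cdot X^+\subset X^+$, $X^++X^+\subset X^+$; $x\le y$ iff $y-x\in X^+$. The cone is generating if $X^+-X^+=X$, and normal if there is $\delta>0$ with $\|x_1\|_X\le\delta\|x_2\|_X$ whenever $0\le x_1\le x_2$. A linear operator on $X$ is positive if it maps $X^+$ into $X^+$. $r(A)$ is the spectral radius of the (automatically bounded) linear operator on $X$ whose restriction is $A$: $r(A)=\lim_{n\to\infty}\|A^n\|^{1/n}$. $\mathcal{K}_\infty$: continuous, strictly increasing, unbounded $\gamma:\mathbb{R}_+\to\mathbb{R}_+$ with $\gamma(0)=0$. A solution for input $u$ is a map $x:\mathbb{Z}_+\to X^+$ satisfying the inequality for all $k$. Inputs are in $\ell_\infty(\mathbb{Z}_+,X^+)$, the set of sequences in $X^+$ with $\|u\|_\infty:=\sup_k\|u(k)\|_X<\infty$. **Exponential ISS (eISS).** There are $M\ge1$, $a\in(0,1)$,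 $\gamma\in\mathcal{K}_\infty$ such that for every $u\in\ell_\infty(\mathbb{Z}_+,X^+)$ and any solution $x(\cdot)$: $\|x(k)\|_X\le M\|x(0)\|_Xa^k+\gamma(\|u\|_\infty)$ for all $k\in\mathbb{Z}_+$. **MLIM.** There is $\xi\in\mathcal{K}_\infty$ such that for every $\varepsilon>0$, every constant input $u(\cdot)\equiv w\in X^+$ and every decreasing solution $x(\cdot)$ (i.e. $x(k+1)\le x(k)$ for all $k$) there is $N\in\mathbb{Z}_+$ (depending on $\varepsilon,u,x(\cdot)$) with $\|x(N)\|_X\le\varepsilon+\xi(\|w\|_X)$. **MBI.** There is $\xi\in\mathcal{K}_\infty$ such that for all $v,w\in X^+$: $(\mathrm{id}-A)(v)\le w\Rightarrow\|v\|_X\le\xi(\|w\|_X)$. *)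

(* Defs.v *)
From HB Require Import structures.
From mathcomp Require Import all_boot all_order all_algebra.
From mathcomp Require Import all_classical all_reals all_analysis.

Set Implicit Arguments.
Unset Strict Implicit.
Unset Printing Implicit Defensive.

Import Order.TTheory GRing.Theory Num.Theory.
Import numFieldNormedType.Exports.

Local Open Scope classical_set_scope.
Local Open Scope ring_scope.

Section OrderedBanachSpace.
Variables (R : realType) (X : completeNormedModType R) (P : set X).

Definition ordered_banach : Prop :=
  [/\ closed P,
      P `&` (-%R @` P) = [set 0],
      forall (c : R) x, 0 <= c -> P x -> P (c *: x)
    & forall x y, P x -> P y -> P (x + y)].

Definition cone_le (x y : X) : Prop := P (y - x).

Definition generating_cone : Prop :=
  forall z, exists x y, [/\ P x, P y & z = x - y].

Definition normal_cone : Prop :=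
  exists2 d : R, 0 < d &
    forall x1 x2, cone_le 0 x1 -> cone_le x1 x2 -> `|x1| <= d * `|x2|.

Definition positive_operator (T : X -> X) : Prop := forall x, P x -> P (T x).

End OrderedBanachSpace.

Section SpectralRadius.
Variables (R : realType) (X : normedModType R).

(* [sup] is 0 on sets without an upper bound, so this is the operator norm
   only for bounded [T]; positive linear operators on a Banach space ordered
   by a generating cone are always bounded. *)
Definition operator_norm (T : X -> X) : R :=
  sup [set `|T x| | x in [set x : X | `|x| <= 1]].

(* The term of index 0 is 1. *)
Definition spectral_radius (T : X -> X) : R :=
  limn (fun n : nat => operator_norm (iter n T) `^ n%:R^-1).

End SpectralRadius.

(* Functions on the half-line are represented by functions on [R], whose
   values on negative reals are irrelevant. *)
Definition class_Kinf (R : realType) (g : R -> R) : Prop :=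
  [/\ {within [set r : R | 0 <= r], continuous g},
      forall r s : R, 0 <= r -> r < s -> g r < g s,
      forall m : R, exists2 r : R, 0 <= r & m < g r
    & g 0 = 0].

Section DiscreteSystem.
Variables (R : realType) (X : completeNormedModType R) (P : set X).

Definition linf_input (u : nat -> X) : Prop :=
  (forall k, P (u k)) /\ exists C : R, forall k, `|u k| <= C.

(* Meaningful for bounded sequences only. *)
Definition linf_norm (u : nat -> X) : R := sup (range (fun k => `|u k|)).

Definition solution (A : X -> X) (u x : nat -> X) : Prop :=
  (forall k, P (x k)) /\ forall k, cone_le P (x k.+1) (A (x k) + u k).

Definition eISS (A : X -> X) : Prop :=
  exists (M a : R) (g : R -> R),
    [/\ 1 <= M, 0 < a < 1, class_Kinf g &
      forall u x, linf_input u -> solution A u x ->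
        forall k, `|x k| <= M * `|x 0%N| * a ^+ k + g (linf_norm u)].

Definition decreasing_solution (A : X -> X) (u x : nat -> X) : Prop :=
  solution A u x /\ forall k, cone_le P (x k.+1) (x k).

Definition MLIM (A : X -> X) : Prop :=
  exists2 xi : R -> R, class_Kinf xi &
    forall (e : R) (w : X) (x : nat -> X), 0 < e -> P w ->
      decreasing_solution A (fun=> w) x ->
      exists N : nat, `|x N| <= e + xi `|w|.

Definition MBI (B : X -> X) : Prop :=
  exists2 xi : R -> R, class_Kinf xi &
    forall v w, P v -> P w -> cone_le P (B v) w -> `|v| <= xi `|w|.

End DiscreteSystem.

(* Main.v *)
(* MBI applied to the partial sums S_n w of the Neumann series gives
   |S_n w| <= C |w|; since (n + 1) A^n w <= S_{n+1} (S_{n+1} w), normality yields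
   |A^n| = O(1/n), so |A^n| < 1 for some n, and r(A) < 1 because r(A) is the
   infimum of |A^n|^(1/n) by Fekete's lemma. Conversely r(A) < 1 means that |A^n|
   decays geometrically, and positivity bounds a solution by
   A^k x(0) + \sum_(i < k) A^i u(k - 1 - i), whence exponential ISS. MLIM yields
   MBI because v - A v <= w makes the constant sequence v a decreasing solution.
   Boundedness of A comes from normality and from a decomposition z = x - y in
   the cone with |x|, |y| <= K |z|, obtained by Baire's theorem. *)
Require Import Defs.
From mathcomp Require Import all_boot all_order all_algebra.
From mathcomp Require Import all_classical all_reals all_analysis.
From mathcomp Require Import ring lra.

Set Implicit Arguments.
Unset Strict Implicit.
Unset Printing Implicit Defensive.

Import Order.TTheory GRing.Theory Num.Theory.
Import numFieldNormedType.Exports.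

Local Open Scope classical_set_scope.
Local Open Scope ring_scope.

(** * Real sequences: geometric bounds and Fekete's lemma *)

Lemma powR_inv_nat_cvg1 (R : realType) (K : R) : 0 < K ->
  (fun n : nat => K `^ n%:R^-1) @ \oo --> (1 : R).
Proof.
move=> K0.
have cn : (fun n : nat => n%:R^-1 : R) @ \oo --> (0 : R).
  by rewrite -(cvg_shiftS _); exact: cvg_harmonic.
have -> : (fun n : nat => K `^ n%:R^-1) = expR \o (fun n : nat => n%:R^-1 * ln K).
  by apply/funext => n; rewrite /powR (gt_eqF K0).
have c0 : (fun n : nat => n%:R^-1 * ln K) @ \oo --> (0 : R).
  by rewrite -[X in _ --> X](mul0r (ln K)); apply: cvgMr_tmp.
by have := cvg_comp _ _ c0 (@continuous_expR R 0); rewrite expR0.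
Qed.

(** Euclidean division of [n] by [m] reduces [s n] to a power of [s m] times [s r] with [r < m]; [K]
    absorbs these finitely many remainders, and its summand 1 makes it positive. *)
Lemma submultiplicative_geometric_bound (R : realType) (s : nat -> R) (m : nat)
    (b : R) :
  (forall n, 0 <= s n) -> (forall i j, s (i + j)%N <= s i * s j) ->
  (0 < m)%N -> 0 < b -> s m <= b ^+ m ->
  exists2 K : R, 0 < K & forall n, s n <= K * b ^+ n.
Proof.
move=> s0 sM m0 b0 smb.
pose K := 1 + \sum_(r < m) s r / b ^+ r.
have K0 : 0 < K.
  rewrite ltr_pwDl// sumr_ge0// => i _; rewrite divr_ge0// exprn_ge0// ltW//.
exists K => // n; rewrite (divn_eq n m).
have rm : (n %% m < m)%N by rewrite ltn_mod.
have sr : s (n %% m)%N <= K * b ^+ (n %% m).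
  rewrite -ler_pdivrMr ?exprn_gt0// /K (bigD1 (Ordinal rm))//= addrCA lerDl.
  by rewrite addr_ge0// sumr_ge0// => i _; rewrite divr_ge0// exprn_ge0// ltW.
elim: (n %/ m)%N => [|q IH]; first by rewrite mul0n.
rewrite mulSn -addnA (le_trans (sM _ _))// exprD mulrCA.
exact: ler_pM.
Qed.

(** The infimum bounds all terms of positive index from below. For [b] above it, the geometric bound
    shows that the [n]-th root of [s n] is at most [b] times the [n]-th root of [K], which tends to
    1. *)
Lemma fekete_root (R : realType) (s : nat -> R) :
  (forall n, 0 <= s n) -> (forall i j, s (i + j)%N <= s i * s j) ->
  (fun n : nat => s n `^ n%:R^-1) @ \oo -->
    inf [set s n `^ n%:R^-1 | n in [set n : nat | (0 < n)%N]].
Proof.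
move=> s0 sM; set f := fun n : nat => s n `^ n%:R^-1; set S := image _ _.
have hS : has_inf S.
  split; first by exists (f 1%N); exists 1%N.
  by exists 0 => _ [n _ <-]; exact: powR_ge0.
have rle n : (0 < n)%N -> inf S <= f n.
  by move=> n0; apply: ge_inf; [case: hS | exists n].
have r0 : 0 <= inf S.
  by apply: lb_le_inf => [|_ [n _ <-]]; [case: hS | exact: powR_ge0].
apply/cvgrPdist_lt => e e0.
(* Half of [e] is spent here, the other half on the distance from [b] to its product with the [n]-th
   root of [K]. *)
pose b := inf S + e / 2.
have b0 : 0 < b by rewrite /b; lra.
have [_ [m m0 <-] fmb] : exists2 y, S y & y < b.
  by apply: (inf_adherent _ hS); lra.
have smb : s m <= b ^+ m.
  have -> : s m = f m ^+ m.
    by rewrite /f -powR_mulrn ?powR_ge0// -powRrM mulVf ?powRr1// pnatr_eq0 -lt0n.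
  by rewrite lerXn2r ?nnegrE ?powR_ge0 ?(ltW b0)// ltW.
have [K K0 sK] := submultiplicative_geometric_bound s0 sM m0 b0 smb.
have cK : (fun n : nat => K `^ n%:R^-1 * b) @ \oo --> b.
  by rewrite -[X in _ --> X]mul1r; apply: cvgMr_tmp; exact: powR_inv_nat_cvg1.
have e2 : 0 < e / 2 by lra.
move/cvgrPdist_lt/(_ _ e2) : cK => cK.
near=> n.
have n0 : (0 < n)%N by near: n; exact: nbhs_infty_gt.
have fn : f n <= K `^ n%:R^-1 * b.
  have -> : b = (b ^+ n) `^ n%:R^-1.
    by rewrite -powR_mulrn ?(ltW b0)// -powRrM divff ?powRr1 ?(ltW b0)// pnatr_eq0 -lt0n.
  have bn0 : 0 <= b ^+ n by rewrite exprn_ge0// ltW.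
  rewrite -powRM ?(ltW K0)//; apply: ge0_ler_powR; rewrite ?nnegrE ?invr_ge0//.
  by rewrite mulr_ge0// ltW.
have : `|b - K `^ n%:R^-1 * b| < e / 2 by near: n.
have := rle n n0.
rewrite /b in fn *; rewrite !ltr_norml => h1 /andP[h2 h3]; lra.
Unshelve. all: by end_near. Qed.

(** Comparison with the geometric series of ratio 1/2. It serves both the decomposition of vectors
    and the boundedness of positive operators. *)
Lemma series_half_cvg (R : realType) (X : completeNormedModType R)
    (u : nat -> X) (C : R) :
  (forall n, `|u n| <= C * 2^-1 ^+ n) ->
  cvgn (series u) /\ `|limn (series u)| <= C * 2.
Proof.
move=> uC.
have h1 : `|2^-1 : R| < 1 by rewrite ger0_norm ?invr_ge0// invf_lt1// ltr1n.
have cg : cvgn (series (geometric C (2^-1)))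
  by exact: is_cvg_geometric_series.
have cn : cvgn [normed series u].
  by apply: (series_le_cvg _ _ uC cg) => n; [|exact: le_trans (uC n)].
split; first exact: normed_cvg.
apply: le_trans (lim_series_norm cn) _.
apply: le_trans (lim_series_le cn cg uC) _.
rewrite (cvg_lim _ (@cvg_geometric_series _ C _ h1))//.
by rewrite le_eqVlt; apply/orP; left; apply/eqP; field.
Qed.

(** * Ordered Banach spaces: bounded decompositions and automatic boundedness *)

Section OrderedBanachSpaceTheory.
Variables (R : realType) (X : completeNormedModType R) (P : set X).
Hypotheses (oP : ordered_banach P) (gP : generating_cone P) (nP : normal_cone P).

Let closedP : closed P. Proof. by case: oP. Qed.

Let coneZ (c : R) x : 0 <= c -> P x -> P (c *: x).
Proof. by case: oP => _ _ + _; apply. Qed.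

Let coneD x y : P x -> P y -> P (x + y).
Proof. by case: oP => _ _ _; apply. Qed.

Lemma cone0 : P 0.
Proof. by have [x [y [/(coneZ (lexx 0)) + _ _]]] := gP 0; rewrite scale0r. Qed.

Lemma cone_sum (I : Type) (r : seq I) (Q : pred I) (F : I -> X) :
  (forall i, Q i -> P (F i)) -> P (\sum_(i <- r | Q i) F i).
Proof. by move=> PF; apply: (big_ind P) => //; exact: cone0. Qed.

Lemma cone_lim_series (u : nat -> X) :
  (forall n, P (u n)) -> cvgn (series u) -> P (limn (series u)).
Proof.
move=> Pu; apply: (closed_cvg P closedP).
by apply: nearW => n; rewrite /series/=; apply: cone_sum.
Qed.

(** Once a partial sum contains [u n], removing it leaves a sum of cone elements; closedness passes
    this to the limit. *)
Lemma cone_term_le_lim_series (u : nat -> X) n :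
  (forall n, P (u n)) -> cvgn (series u) -> cone_le P (u n) (limn (series u)).
Proof.
move=> Pu cu; rewrite /cone_le.
have c : (series u k - u n) @[k --> \oo] --> limn (series u) - u n.
  by apply: cvgB => //; exact: cvg_cst.
apply: (closed_cvg P closedP _ _ c); near=> k.
have nk : (n < k)%N by near: k; exact: nbhs_infty_gt.
rewrite seriesEord/= (bigD1 (Ordinal nk))//= addrAC subrr add0r.
by apply: cone_sum => i _.
Unshelve. all: by end_near. Qed.

Lemma cone_leD x y z t :
  cone_le P x y -> cone_le P z t -> cone_le P (x + z) (y + t).
Proof. by rewrite /cone_le opprD addrACA; exact: coneD. Qed.

Lemma cone_le_trans y x z : cone_le P x y -> cone_le P y z -> cone_le P x z.
Proof. by move=> xy yz; have := coneD yz xy; rewrite addrA subrK. Qed.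

Lemma cone_lexx x : cone_le P x x.
Proof. by rewrite /cone_le subrr; exact: cone0. Qed.

(* By Baire, some set [closure (E n)] below has an interior point; being convex
   and symmetric, it is then a neighbourhood of 0. *)
Lemma generating_approx_decomposition :
  exists2 K : R, 0 <= K & forall z, exists p : X * X,
    [/\ P p.1, P p.2, `|p.1| <= K * `|z|, `|p.2| <= K * `|z| &
        `|z - (p.1 - p.2)| <= `|z| / 2].
Proof.
pose E (n : nat) := [set z | exists x y,
  [/\ P x, P y, `|x| <= n%:R, `|y| <= n%:R & z = x - y]].
have [n [V [oV [z0 Vz0] VE]]] : exists n (V : set X),
    [/\ open V, V !=set0 & V `<=` closure (E n)].
  apply: contrapT => noE.
  have dE i : open (~` closure (E i)) /\ dense (~` closure (E i)).
    split; first by rewrite openC; exact: closed_closure.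
    move=> V V0 oV; apply: contrapT => /set0P/negP; rewrite negbK => /eqP VE.
    apply: noE; exists i, V; split => // x Ox; apply: contrapT => nx.
    by have : (V `&` ~` closure (E i)) x by []; rewrite VE.
  have [|z [_ zE]] := Baire dE _ openT; first by exists 0.
  have [x [y [Px Py zxy]]] := gP z.
  pose k := (Num.trunc (`|x| + `|y|)).+1.
  apply: (zE k I); apply: subset_closure; exists x, y.
  have k1 : `|x| + `|y| < k%:R by rewrite truncnS_gt.
  have := normr_ge0 x; have := normr_ge0 y; move=> y0 x0.
  by split=> //; lra.
have [r /= r0 rV] : exists2 r : R, 0 < r & ball z0 r `<=` V.
  by have /nbhs_ballP[r /= r0 rV] := open_nbhs_nbhs (conj oV Vz0); exists r.
have near h e : `|h| < r -> 0 < e -> exists x y,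
    [/\ P x, P y, `|x| <= n%:R, `|y| <= n%:R & `|h - (x - y)| < e].
  move=> hr e0.
  have cl h' : `|h'| < r -> exists a, E n a /\ `|(z0 + h') - a| < e.
    move=> h'r.
    have /VE/(_ (ball (z0 + h') e)) : V (z0 + h').
      by apply: rV; rewrite -ball_normE/= opprD addNKr normrN.
    by case=> [|a [Ea]]; [exact: nbhsx_ballx | rewrite -ball_normE; exists a].
  have [_ [[a1 [b1 [Pa1 Pb1 a1n b1n ->]]] d1]] := cl h hr.
  have [|_ [[a2 [b2 [Pa2 Pb2 a2n b2n ->]]] d2]] := cl (- h); first by rewrite normrN.
  have half2 x y : P x -> P y -> `|x| <= n%:R -> `|y| <= n%:R ->
      P (2^-1 *: (x + y)) /\ `|2^-1 *: (x + y)| <= n%:R.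
    move=> Px Py xn yn; split; first by apply: coneZ; rewrite ?invr_ge0//; exact: coneD.
    rewrite normrZ ger0_norm ?invr_ge0//.
    by have := ler_normD x y; lra.
  have [Px xn] := half2 _ _ Pa1 Pb2 a1n b2n.
  have [Py yn] := half2 _ _ Pb1 Pa2 b1n a2n.
  exists (2^-1 *: (a1 + b2)), (2^-1 *: (b1 + a2)); split=> //.
  (* The centre [z0] cancels because [h] is half the difference of [z0 + h] and [z0 - h]; pairing
     [a1] with [b2] and [b1] with [a2] keeps both parts in the cone. *)
  have -> : h - (2^-1 *: (a1 + b2) - 2^-1 *: (b1 + a2)) =
      2^-1 *: ((z0 + h - (a1 - b1)) - (z0 - h - (a2 - b2))).
    have hh : z0 + h - (z0 - h) = h + h by rewrite opprB addrC -addrA addKr.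
    have ab : a1 + b2 - (b1 + a2) = a1 - b1 - (a2 - b2).
      by rewrite !opprB !opprD addrACA [b2 - a2]addrC.
    rewrite -scalerBr ab [- (z0 - h - _)]opprD addrACA hh -opprD -mulr2n -[h *+ 2]scaler_nat.
    by rewrite [in RHS]scalerBr scalerA mulVf ?pnatr_eq0// scale1r.
  rewrite normrZ ger0_norm ?invr_ge0//.
  have := ler_normB (z0 + h - (a1 - b1)) (z0 - h - (a2 - b2)).
  lra.
(* A nonzero [z] is scaled by [t] to norm [r / 2], where parts of norm at most [n%:R] are available.
   Scaling back multiplies by [2 / r] times the norm of [z], and turns the error [r / 4] into half
   that norm. *)
exists (n%:R * 2 / r).
  by rewrite divr_ge0// ?mulr_ge0// ltW.
move=> z; have [->|z0'] := eqVneq z 0.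
  exists (0, 0) => /=; rewrite subrr subr0 normr0 mulr0 mul0r.
  by split => //; exact: cone0.
have nz : 0 < `|z| by rewrite normr_gt0.
pose t := r / 2 / `|z|.
have t0 : 0 < t by rewrite !divr_gt0.
have tz : `|t *: z| = r / 2.
  by rewrite normrZ gtr0_norm// divfK// gt_eqF.
have [||x [y [Px Py xn yn hxy]]] := near (t *: z) (r / 4); [|by lra|].
  by rewrite tz; lra.
have bd w : `|w| <= n%:R -> `|t^-1 *: w| <= n%:R * 2 / r * `|z|.
  move=> wn; rewrite normrZ gtr0_norm ?invr_gt0//.
  rewrite mulrC ler_pdivrMr// (le_trans wn)// /t le_eqVlt; apply/orP; left.
  by apply/eqP; field; rewrite !gt_eqF.
exists (t^-1 *: x, t^-1 *: y); split => /=; rewrite ?bd//.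
- by apply: coneZ; rewrite // invr_ge0 ltW.
- by apply: coneZ; rewrite // invr_ge0 ltW.
have -> : z - (t^-1 *: x - t^-1 *: y) = t^-1 *: (t *: z - (x - y)).
  by rewrite !scalerBr scalerA mulVf ?scale1r// gt_eqF.
rewrite normrZ gtr0_norm ?invr_gt0// mulrC ler_pdivrMr//.
have -> : `|z| / 2 * t = r / 4 by rewrite /t; field; rewrite gt_eqF.
exact: ltW.
Qed.

(** The approximate decomposition is applied repeatedly to the remainder [w n], whose norm is at
    least halved each time; the parts then form convergent series with sums in the closed cone. *)
Lemma generating_bounded_decomposition :
  exists2 K : R, 0 <= K & forall z, exists x y,
    [/\ P x, P y, z = x - y, `|x| <= K * `|z| & `|y| <= K * `|z|].
Proof.
have [K K0 /choice[f fP]] := generating_approx_decomposition.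
exists (K * 2); first by rewrite mulr_ge0.
move=> z.
pose w := fix w n := if n is m.+1 then w m - ((f (w m)).1 - (f (w m)).2) else z.
have wn n : `|w n| <= `|z| * 2^-1 ^+ n.
  elim: n => [|n IH] /=; first by rewrite mulr1.
  have [_ _ _ _ h] := fP (w n).
  by apply: le_trans h _; rewrite exprSr mulrA ler_pM2r// invr_gt0.
have Kw n : K * `|w n| <= K * `|z| * 2^-1 ^+ n by rewrite -mulrA ler_wpM2l.
have [c1 l1] : cvgn (series (fun n => (f (w n)).1)) /\
    `|limn (series (fun n => (f (w n)).1))| <= K * `|z| * 2.
  by apply: series_half_cvg => n; have [_ _ h _ _] := fP (w n); exact: le_trans h _.
have [c2 l2] : cvgn (series (fun n => (f (w n)).2)) /\
    `|limn (series (fun n => (f (w n)).2))| <= K * `|z| * 2.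
  by apply: series_half_cvg => n; have [_ _ _ h _] := fP (w n); exact: le_trans h _.
exists (limn (series (fun n => (f (w n)).1))), (limn (series (fun n => (f (w n)).2))).
split; rewrite 1?[K * 2 * _]mulrAC//.
- by apply: cone_lim_series => // n; have [] := fP (w n).
- by apply: cone_lim_series => // n; have [] := fP (w n).
have c3 := cvgB c1 c2.
have w0 : w n @[n --> \oo] --> (0 : X).
  have g0 : `|z| * 2^-1 ^+ n @[n --> \oo] --> (0 : R).
    by apply: cvg_geometric; rewrite ger0_norm ?invr_ge0// invf_lt1// ltr1n.
  apply/norm_cvg0P; apply: (squeeze_cvgr _ (cvg_cst 0) g0).
  by apply: nearW => n; rewrite normr_ge0 wn.
have c4 : z - w n @[n --> \oo] --> z - 0 by apply: cvgB => //; exact: cvg_cst.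
rewrite subr0 in c4.
apply: (@cvg_unique _ (@norm_hausdorff _ X) _ _ _ _ c4).
(* The corrections telescope, so both limits of [z - w n] must agree. *)
suff -> : (fun n => z - w n) =
  series (fun n => (f (w n)).1) - series (fun n => (f (w n)).2) by exact: c3.
apply/funext => n.
change (z - w n = \sum_(0 <= k < n) (f (w k)).1 - \sum_(0 <= k < n) (f (w k)).2).
elim: n => [|n IH]; first by rewrite !big_geq//= !subrr.
by rewrite !big_nat_recr//= opprB [in RHS]opprD [RHS]addrACA -IH [LHS]addrA [LHS]addrAC.
Qed.

(** Were [A] unbounded on the cone, cone vectors of norm at most [2^-n] would have images of norm at
    least [2^n]. Their sum [s] dominates each of them, so by normality [d] times the norm of [A s]
    would exceed every [2^n]. The decomposition extends the bound to all of [X]. *)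
Lemma positive_linear_bounded (A : {linear X -> X}) :
  positive_operator P A -> exists2 K : R, 0 < K & forall x, `|A x| <= K * `|x|.
Proof.
move=> PA; have [d d0 dP] := nP.
have [K KP] : exists K : R, forall x, P x -> `|A x| <= K * `|x|.
  apply: contrapT => noK.
  have /choice[x xP] : forall n : nat, exists x, [/\ P x,
      `|x| <= 1 * 2^-1 ^+ n & 2 ^+ n <= `|A x|].
    (* A vector violating the bound [4 ^+ n], once scaled to norm [2^-n], has an image of norm at
       least [2^n]. *)
    move=> n; apply: contrapT => nox; apply: noK; exists (4 ^+ n) => x Px.
    rewrite leNgt; apply/negP => hx; apply: nox.
    have x0 : 0 < `|x|.
      rewrite normr_gt0; apply/eqP => x0.
      by move: hx; rewrite x0 linear0 normr0 mulr0 ltxx.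
    have c0 : 0 <= (2 ^+ n * `|x|)^-1 by rewrite invr_ge0 mulr_ge0// exprn_ge0.
    exists ((2 ^+ n * `|x|)^-1 *: x); split; first exact: coneZ.
      rewrite normrZ ger0_norm// invfM mulfVK ?gt_eqF//; by rewrite mul1r exprVn.
    rewrite linearZ normrZ ger0_norm//= mulrC ler_pdivlMr ?mulr_gt0 ?exprn_gt0//.
    apply: le_trans (ltW hx); rewrite mulrA -exprMn -natrM.
    by [].
  have [cx _] : cvgn (series x) /\ _ := series_half_cvg (fun n => let: And3 _ h _ := xP n in h).
  have Px n : P (x n) by case: (xP n).
  set s := limn (series x) in cx.
  have key n : 2 ^+ n <= d * `|A s|.
    have [_ _ h] := xP n; apply: le_trans h _; apply: dP.
      by rewrite /cone_le subr0; exact: PA.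
    by rewrite /cone_le -linearB; apply: PA; exact: cone_term_le_lim_series.
  have := truncnS_gt (d * `|A s|); apply/negP; rewrite -leNgt.
  apply: le_trans (key (Num.trunc (d * `|A s|)).+1).
  by rewrite -natrX ler_nat ltnW// ltn_expl.
have [L L0 LP] := generating_bounded_decomposition.
(* [K] may be negative, hence its absolute value; 2 counts the two parts of [z], and 1 makes the
   constant positive. *)
exists (2 * `|K| * L + 1); first by rewrite ltr_wpDl// !mulr_ge0.
move=> z; have [x [y [Px Py zxy xz yz]]] := LP z; rewrite {1}zxy linearB.
have bd w : P w -> `|w| <= L * `|z| -> `|A w| <= `|K| * (L * `|z|).
  move=> Pw wz; apply: le_trans (KP w Pw) _.
  by apply: le_trans (ler_wpM2r _ (ler_norm K)) _; rewrite ?ler_wpM2l.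
apply: le_trans (ler_normB _ _) _.
apply: le_trans (lerD (bd _ Px xz) (bd _ Py yz)) _.
by have := normr_ge0 z; lra.
Qed.
End OrderedBanachSpaceTheory.

(** * The operator norm as a supremum over the unit ball *)

Section OperatorNorm.
Variables (R : realType) (X : normedModType R).
Implicit Types (T : X -> X) (K : R).

Lemma operator_norm_le T K :
  (forall x, `|x| <= 1 -> `|T x| <= K) -> operator_norm T <= K.
Proof.
move=> TK; apply: ge_sup => [|_ [x x1 <-]]; last exact: TK.
by exists `|T 0|; exists 0 => //=; rewrite normr0.
Qed.

(** The bound by [K] makes the supremum a genuine one, and homogeneity allows [x] to be
    normalized. *)
Lemma norm_le_operator_norm T K x :
  (forall x, `|T x| <= K * `|x|) -> (forall (c : R) x, T (c *: x) = c *: T x) ->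
  `|T x| <= operator_norm T * `|x|.
Proof.
move=> TK TZ; have [->|x0] := eqVneq x 0.
  by rewrite normr0 mulr0 (le_trans (TK _))// normr0 mulr0.
have nx : 0 < `|x| by rewrite normr_gt0.
rewrite -ler_pdivrMr// mulrC -[_^-1]ger0_norm ?invr_ge0// -normrZ -TZ.
apply: ub_le_sup.
  exists `|K| => _ [y /= y1 <-]; apply: le_trans (TK y) _.
  apply: le_trans (ler_norm _) _; rewrite normrM normr_id.
  by rewrite ler_piMr.
by exists (`|x|^-1 *: x) => //=; rewrite normrZ ger0_norm ?invr_ge0// mulVf ?gt_eqF.
Qed.

Lemma operator_norm_ge0 T : 0 <= operator_norm T.
Proof.
have [hs|nhs] := pselect (has_sup [set `|T x| | x in [set x : X | `|x| <= 1]]); last first.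
  by rewrite /operator_norm sup_out.
apply: le_trans (normr_ge0 (T 0)) _; apply: ub_le_sup; first by case: hs.
by exists 0 => //=; rewrite normr0.
Qed.

End OperatorNorm.

(** * Iterates of a bounded operator and the spectral radius *)

Section IteratedOperator.
Variables (R : realType) (X : normedModType R) (A : {linear X -> X}).

Lemma iter_linearZ n (c : R) x : iter n A (c *: x) = c *: iter n A x.
Proof. by elim: n => //= n ->; rewrite linearZ. Qed.

Lemma iter_linearB n x y : iter n A (x - y) = iter n A x - iter n A y.
Proof. by elim: n => //= n ->; rewrite linearB. Qed.

Lemma iter_linear_sum n (I : Type) (r : seq I) (F : I -> X) :
  iter n A (\sum_(i <- r) F i) = \sum_(i <- r) iter n A (F i).
Proof. by elim: n => //= n ->; rewrite linear_sum. Qed.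

Variable K : R.
Hypotheses (K0 : 0 < K) (AK : forall x, `|A x| <= K * `|x|).

Lemma iter_bounded n x : `|iter n A x| <= K ^+ n * `|x|.
Proof.
elim: n => [|n IH] /=; first by rewrite mul1r.
by rewrite (le_trans (AK _))// exprS -mulrA ler_pM2l.
Qed.

Lemma norm_iter_le n x : `|iter n A x| <= operator_norm (iter n A) * `|x|.
Proof.
exact: (norm_le_operator_norm _ (iter_bounded n) (iter_linearZ n)).
Qed.

Lemma operator_norm_iterD i j :
  operator_norm (iter (i + j) A) <= operator_norm (iter i A) * operator_norm (iter j A).
Proof.
apply: operator_norm_le => x x1; rewrite iterD (le_trans (norm_iter_le _ _))//.
rewrite ler_wpM2l ?operator_norm_ge0// (le_trans (norm_iter_le _ _))//.
by rewrite ler_piMr ?operator_norm_ge0.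
Qed.

Let s n := operator_norm (iter n A).
Let S := [set s n `^ n%:R^-1 | n in [set n : nat | (0 < n)%N]].

(** Norms of iterates are submultiplicative, so Fekete's lemma applies; as an infimum, the radius
    can be tested on a single iterate. *)
Lemma spectral_radius_inf : spectral_radius A = inf S.
Proof.
apply: cvg_lim => //; apply: fekete_root => [n|]; first exact: operator_norm_ge0.
exact: operator_norm_iterD.
Qed.

Lemma spectral_radius_lt1P :
  spectral_radius A < 1 <-> exists2 n, (0 < n)%N & operator_norm (iter n A) < 1.
Proof.
rewrite spectral_radius_inf; split=> [r1|[n n0 sn]].
  have S0 : S !=set0 by exists (s 1 `^ 1%:R^-1), 1%N.
  have [_ [n n0 <-] h] := inf_lt S0 r1.
  exists n => //; rewrite ltNge; apply/negP => s1; move: h; apply/negP.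
  by rewrite -leNgt -[X in X <= _](powRr0 (s n)) ler_powR// invr_ge0.
apply: (@le_lt_trans _ _ (s n `^ n%:R^-1)).
  by apply: ge_inf; [exists 0 => _ [m _ <-]; exact: powR_ge0|exists n].
rewrite -[X in _ < X](congr1 (@^~ n%:R^-1) (powR1 R)); apply: gt0_ltr_powR; rewrite ?nnegrE//.
- by rewrite invr_gt0 ltr0n.
- exact: operator_norm_ge0.
Qed.

Lemma spectral_radius_lt1_geometric : spectral_radius A < 1 ->
  exists M a : R, [/\ 0 < M, 0 < a < 1 & forall n x, `|iter n A x| <= M * a ^+ n * `|x|].
Proof.
move=> /spectral_radius_lt1P[n n0]; rewrite -/(s n) => sn.
have [a a01 sa] : exists2 a : R, 0 < a < 1 & s n <= a ^+ n.
  (* The midpoint, rather than [s n] itself, keeps [a] positive even when the iterate vanishes. *)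
  pose c := (s n + 1) / 2; have c0 : 0 < c.
    by rewrite /c divr_gt0// ltr_wpDl// operator_norm_ge0.
  have c1 : c < 1 by rewrite /c; lra.
  exists (c `^ n%:R^-1).
    rewrite powR_gt0//= -[X in _ < X](congr1 (@^~ n%:R^-1) (powR1 R)).
    by apply: gt0_ltr_powR; rewrite ?nnegrE ?invr_gt0 ?ltr0n ?(ltW c0).
  rewrite -powR_mulrn ?powR_ge0// -powRrM mulVf ?powRr1 ?(ltW c0)// ?pnatr_eq0 -?lt0n//.
  by rewrite /c; lra.
have [a0 _] := andP a01.
have [M M0 sM] := submultiplicative_geometric_bound
  (fun n => operator_norm_ge0 (iter n A)) operator_norm_iterD n0 a0 sa.
exists M, a; split=> // k x; apply: le_trans (norm_iter_le k x) _.
by rewrite ler_wpM2r.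
Qed.

End IteratedOperator.

(** Supplies the gain for exponential ISS, which is linear in the norm of the input. *)
Lemma class_Kinf_linear (R : realType) (c : R) : 0 < c -> class_Kinf ( *%R c).
Proof.
move=> c0; split; last exact: mulr0.
- by apply: continuous_subspaceT => x; apply: cvgMl_tmp; exact: cvg_id.
- by move=> r s _ rs; rewrite ltr_pM2l.
- move=> m; exists ((`|m| + 1) / c); first by rewrite divr_ge0// ltW.
  by rewrite mulrC divfK ?gt_eqF// (le_lt_trans (ler_norm m))// ltrDl.
Qed.

(** * Positive systems: the cycle of implications *)

Section PositiveSystem.
Variables (R : realType) (X : completeNormedModType R) (P : set X).
Variable A : {linear X -> X}.
Hypotheses (oP : ordered_banach P) (gP : generating_cone P) (nP : normal_cone P).
Hypothesis PA : positive_operator P A.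

Lemma iter_positive n : positive_operator P (iter n A).
Proof. by elim: n => // n IH x Px; apply: PA; exact: IH. Qed.

(** Comparison with the variation-of-constants formula; in the induction step positivity makes [A]
    monotone. *)
Lemma solution_le (u x : nat -> X) k : solution P A u x ->
  cone_le P (x k) (iter k A (x 0%N) + \sum_(i < k) iter i A (u (k - i.+1)%N)).
Proof.
move=> [_ xA]; elim: k => [|k IH]; first by rewrite big_ord0 addr0; exact: cone_lexx.
apply: (cone_le_trans oP (xA k)); rewrite big_ord_recl/= subn1 addrCA [_ + u k]addrC.
apply: (cone_leD oP (cone_lexx oP gP _)).
under eq_bigr do rewrite subSS.
rewrite -linear_sum -linearD /cone_le -linearB; exact: PA.
Qed.

(** The gain [g] serves as [xi], since a constant input has the norm of its value; the decaying
    transient drops below [e] at some time. *)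
Lemma eISS_MLIM : eISS P A -> MLIM P A.
Proof.
move=> [M [a [g [M1 /andP[a0 a1] gK H]]]]; exists g => // e w x e0 Pw [xs _].
have lw : linf_input P (fun=> w) by split=> //; exists `|w|.
have nw : linf_norm (fun=> w) = `|w|.
  rewrite /linf_norm (_ : range _ = [set `|w|]) ?sup1//.
  by apply/seteqP; split=> [_ [_ _ <-]|_ ->] //; exists 0%N.
have c0 : M * `|x 0%N| * a ^+ k @[k --> \oo] --> (0 : R).
  by apply: cvg_geometric; rewrite gtr0_norm.
have [k kP] := filter_ex (cvgr_lt _ c0 _ e0).
exists k; rewrite -nw; apply: le_trans (H _ _ lw xs k) _.
by rewrite lerD2r ltW.
Qed.

Lemma MLIM_MBI : MLIM P A -> MBI P (fun x => x - A x).
Proof.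
move=> [xi xiK H]; exists xi => // v w Pv Pw vw.
(* Along the constant sequence [v] the time [N] does not matter, so [e] can be made arbitrarily
   small. *)
apply/ler_addgt0Pl => e e0.
have [|N] := H e w (fun=> v) e0 Pw; last by [].
split=> [|k]; last exact: cone_lexx.
by split=> // k; move: vw; rewrite /cone_le opprB addrA [w + _]addrC.
Qed.

(** The premise is homogeneous: scaling [w] to norm 1 replaces [xi] by the linear gain of slope
    [xi 1], and [w = 0] is settled by [xi 0 = 0]. *)
Lemma MBI_linear_bound : MBI P (fun x => x - A x) ->
  exists2 C : R, 0 < C & forall v w, P v -> P w -> cone_le P (v - A v) w ->
    `|v| <= C * `|w|.
Proof.
move=> [xi [_ xi_incr _ xi0] H]; exists (xi 1); first by rewrite -xi0 xi_incr.
move=> v w Pv Pw vw; have [w0|w0] := eqVneq w 0.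
  by have := H v w Pv Pw vw; rewrite w0 normr0 xi0 mulr0.
have nw : 0 < `|w| by rewrite normr_gt0.
have t0 : 0 <= `|w|^-1 by rewrite invr_ge0.
have Z := let: And4 _ _ Z _ := oP in Z.
have := H (`|w|^-1 *: v) (`|w|^-1 *: w) (Z _ _ t0 Pv) (Z _ _ t0 Pw).
rewrite !normrZ ger0_norm// mulVf ?gt_eqF// linearZ/= /cone_le -!scalerBr.
by move=> /(_ (Z _ _ t0 vw)); rewrite mulrC ler_pdivrMr.
Qed.

(* The partial sum [v] of [A ^ i w], [i < n], satisfies [v - A v = w - A ^ n w],
   so MBI applies to it. *)
Lemma neumann_partial_sum_bound (C : R) :
  (forall v w, P v -> P w -> cone_le P (v - A v) w -> `|v| <= C * `|w|) ->
  forall n w, P w -> `|\sum_(i < n) iter i A w| <= C * `|w|.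
Proof.
move=> H n w Pw; apply: H => //.
  by apply: (cone_sum oP gP) => i _; exact: iter_positive.
have -> : \sum_(i < n) iter i A w - A (\sum_(i < n) iter i A w) = w - iter n A w.
  elim: n => [|n IH]; first by rewrite big_ord0 linear0 !subrr.
  rewrite big_ord_recr/= linearD opprD addrACA IH addrA subrK//.
by rewrite /cone_le subKr; exact: iter_positive.
Qed.

Lemma MBI_iter_decay : MBI P (fun x => x - A x) ->
  exists2 D : R, 0 <= D & forall n x, `|iter n A x| <= D / n.+1%:R * `|x|.
Proof.
move=> /MBI_linear_bound[C C0 /neumann_partial_sum_bound SC].
have [d d0 dP] := nP; have [L L0 LP] := generating_bounded_decomposition oP gP.
have onP n w : P w -> `|iter n A w| <= d * (C * C) / n.+1%:R * `|w|.
  move=> Pw; pose v := \sum_(i < n.+1) iter i A w.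
  have Pv : P v by apply: (cone_sum oP gP) => i _; exact: iter_positive.
  (* For each outer index [i], the inner term of index [n - i] contributes exactly [iter n A w]; all
     other terms lie in the cone. *)
  have h : cone_le P (iter n A w *+ n.+1) (\sum_(i < n.+1) iter i A v).
    rewrite /cone_le -[X in _ *+ X]card_ord -sumr_const -sumrB.
    apply: (cone_sum oP gP) => i _; rewrite /v iter_linear_sum.
    have ni : (n - i < n.+1)%N by rewrite ltnS leq_subr.
    rewrite (bigD1 (Ordinal ni))//= -iterD subnKC -1?ltnS//.
    rewrite addrAC subrr add0r.
    by apply: (cone_sum oP gP) => j _; do 2 apply: iter_positive.
  have h0 : cone_le P 0 (iter n A w *+ n.+1).
    rewrite /cone_le subr0 -[n.+1]card_ord -sumr_const.
    by apply: (cone_sum oP gP) => i _; exact: iter_positive.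
  rewrite mulrAC ler_pdivlMr ?ltr0n// mulr_natr -normrMn.
  apply: le_trans (dP _ _ h0 h) _; rewrite -!mulrA ler_pM2l//.
  by apply: le_trans (SC _ _ Pv) _; rewrite ler_pM2l//; exact: SC.
(* [d] comes from normality, [C * C] from the two nested partial sums, and [L * 2] from the two cone
   parts of [z]. *)
exists (d * (C * C) * L * 2); first by rewrite !mulr_ge0// ltW.
move=> n z; have [x [y [Px Py zxy xz yz]]] := LP z.
rewrite {1}zxy iter_linearB; apply: le_trans (ler_normB _ _) _.
have -> : d * (C * C) * L * 2 / n.+1%:R = d * (C * C) / n.+1%:R * L * 2 by ring.
have : 0 <= d * (C * C) / n.+1%:R by rewrite divr_ge0// !mulr_ge0// ltW.
have := lerD (onP n _ Px) (onP n _ Py).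
move: (d * _ / _) => c h c0.
have := ler_wpM2l c0 xz; have := ler_wpM2l c0 yz; lra.
Qed.

Lemma MBI_spectral_radius_lt1 :
  MBI P (fun x => x - A x) -> spectral_radius A < 1.
Proof.
have [K K0 AK] := positive_linear_bounded oP gP nP PA.
move=> /MBI_iter_decay[D D0 AD]; apply/(spectral_radius_lt1P K0 AK).
(* This index produces the denominator [(Num.trunc D).+2], which exceeds [D]. *)
exists (Num.trunc D).+1 => //; apply: (@le_lt_trans _ _ (D / (Num.trunc D).+2%:R)).
  apply: operator_norm_le => x x1; apply: le_trans (AD _ x) _.
  by rewrite ler_piMr// divr_ge0.
rewrite ltr_pdivrMr ?ltr0n// mul1r (lt_trans (truncnS_gt D))//.
by rewrite ltr_nat.
Qed.

Lemma spectral_radius_lt1_eISS : spectral_radius A < 1 -> eISS P A.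
Proof.
have [K K0 AK] := positive_linear_bounded oP gP nP PA.
move=> /(spectral_radius_lt1_geometric K0 AK)[M [a [M0 /andP[a0 a1] AM]]].
have [d d0 dP] := nP.
have b0 : 0 < d * (M / (1 - a)) by rewrite mulr_gt0// divr_gt0// subr_gt0.
(* [M / (1 - a)] bounds the sum of the weights [M * a ^+ i] on the inputs, [d] comes from normality,
   and the maximum secures the required lower bound 1. *)
exists (Num.max 1 (d * M)), a, ( *%R (d * (M / (1 - a)))); split.
- by rewrite le_max lexx.
- by rewrite a0.
- exact: class_Kinf_linear.
move=> u x [Pu [C uC]] xs k; set U := linf_norm u.
have uU i : `|u i| <= U.
  apply: ub_le_sup; last by exists i.
  by exists C => _ [j _ <-].
have sU : `|\sum_(i < k) iter i A (u (k - i.+1)%N)| <= M / (1 - a) * U.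
  apply: le_trans (ler_norm_sum _ _ _) _.
  apply: (@le_trans _ _ ((\sum_(i < k) M * a ^+ i) * U)).
    rewrite mulr_suml ler_sum// => i _; apply: le_trans (AM _ _) _.
    by rewrite ler_wpM2l// mulr_ge0 ?exprn_ge0// ltW.
  rewrite ler_wpM2r ?(le_trans _ (uU 0%N))//.
  have := @geometric_le_lim R k M a (ltW M0) a0; rewrite seriesEord/=.
  by apply; rewrite gtr0_norm.
have x0 : cone_le P 0 (x k) by rewrite /cone_le subr0; case: xs.
apply: le_trans (dP _ _ x0 (solution_le k xs)) _.
apply: (@le_trans _ _ (d * (M * a ^+ k * `|x 0%N| + M / (1 - a) * U))).
  rewrite ler_pM2l//; apply: le_trans (ler_normD _ _) _.
  by rewrite lerD.
rewrite mulrDr -[d * _ * U]mulrA lerD2r !mulrA [d * M * _ * _]mulrAC.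
by rewrite !ler_wpM2r ?exprn_ge0 ?(ltW a0)// le_max lexx orbT.
Qed.

End PositiveSystem.

Theorem proposition7p16 (R : realType) (X : completeNormedModType R)
    (P : set X) (A : {linear X -> X}) :
  ordered_banach P -> generating_cone P -> normal_cone P ->
  positive_operator P A ->
  [<-> eISS P A;
       MLIM P A;
       MBI P (fun x => x - A x);
       spectral_radius A < 1].
Proof.
move=> oP gP nP PA; tfae.
- exact: eISS_MLIM.
- exact: MLIM_MBI.
- exact: MBI_spectral_radius_lt1.
- exact: spectral_radius_lt1_eISS.
Qed.
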